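(* Let $q$ be a left-invariant pseudo-Riemannian metric on $\mathrm{SL}(2,\mathbb{R})$ with associated isomorphism $\Phi$, and suppose that $\Phi$ has two complex (non-real) eigenvalues. Then there exists a plane (two-dimensional linear subspace of $\mathfrak{sl}(2,\mathbb{R})$), invariant under the geodesic flow, over which all geodesics are complete. Furthermore, there exists an invariant plane over which some of the geodesics are $\mathbb{R}^+$-complete or $\mathbb{R}^-$-complete and the others have a finite interval $]\alpha,\beta[$ ($\alpha<\beta$ real) as maximal domain of definition. All the remaining geodesics (those lying over neither of these two planes) are incomplete with a finite interval as maximal domain of definition.
   Context: Let $B(x,y)=2\,\mathrm{Tr}(xy)$ on $\mathfrak{sl}(2,\mathbb{R})$ (one half of the Killing form). The associated isomorphism of a left-invariant pseudo-Riemannian metric $q$ is the unique $B$-self-adjoint linear isomorphism $\Phi$ of $\mathfrak{sl}(2,\mathbb{R})$ with $q(x,y)=B(\Phi x,y)$ for all $x,y\in\mathfrak{sl}(2,\mathbb{R})$. A curve $\gamma$ in $\mathrm{SL}(2,\mathbb{R})$ is a geodesic of $q$ if and only if $z(t)=\Phi(\gamma(t)^{-1}\dot\gamma(t))$ solves the quadratic (Lax/Euler–Arnold) equation $\dot z=[z,\Phi^{-1}z]$ on $\mathfrak{sl}(2,\mathbb{R})$, and maximal geodesics and the corresponding maximal solutions have the same interval of definition. Geodesics are identified with the solutions of this equation; invariance of a plane means invariance under this equation, and a geodesic is ''over'' the plane if the corresponding solution $z(t)$ lies in it. A geodesic is complete if its maximal interval of definition is $\mathbb{R}$; it is $\mathbb{R}^+$-complete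 (resp. $\mathbb{R}^-$-complete) if its maximal interval of definition is unbounded above (resp. below). In particular a complete geodesic is both $\mathbb{R}^+$- and $\mathbb{R}^-$-complete. *)

(* Defs.v *)
From HB Require Import structures.
From mathcomp Require Import all_boot all_order all_algebra.
From mathcomp Require Import all_classical all_reals all_analysis.
From mathcomp Require Import complex.

Set Implicit Arguments.
Unset Strict Implicit.
Unset Printing Implicit Defensive.

Import Order.TTheory GRing.Theory Num.Theory.
Import numFieldNormedType.Exports.

Local Open Scope classical_set_scope.
Local Open Scope ring_scope.

Definition sl2v (R : realType) : {vspace 'M[R]_2} :=
  lker (linfun (@mxtrace R 2 : 'M[R]_2 -> R^o)).

Notation sl2 R := (subvs_of (sl2v R)).

Definition bracket (R : realType) (x y : 'M[R]_2) : 'M[R]_2 :=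
  x *m y - y *m x.

(* One half of the Killing form of sl(2,R), which is 4 Tr(xy). *)
Definition B (R : realType) (x y : sl2 R) : R :=
  2 * \tr (vsval x *m vsval y).

(* A left-invariant pseudo-Riemannian metric on SL(2,R) is given by its value
   at the identity, a nondegenerate symmetric bilinear form q on sl(2,R). *)
Definition is_associated_iso (R : realType) (q : {symmetric (sl2 R)})
    (Phi : 'End(sl2 R)) : Prop :=
  [/\ lker Phi = 0%VS,
      forall x y, B (Phi x) y = B x (Phi y)
    & forall x y, q x y = B (Phi x) y].

(* Eigenvalues of the complexification of Phi, through its matrix in a real
   basis; they do not depend on the basis. *)
Definition complex_eigenvalue (R : realType) (Phi : 'End(sl2 R))
    (l : R[i]) : Prop :=
  eigenvalue
    (map_mx (real_complex R)
       (passmx.mxof (vbasis {: sl2 R}) (vbasis {: sl2 R}) Phi)) l.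

(* The geodesic is the pair of the interval J and the restriction of z to J;
   the values of z outside J are irrelevant. *)
Definition geodesic_on (R : realType) (Phi : 'End(sl2 R))
    (J : set R) (z : R -> sl2 R) : Prop :=
  [/\ J !=set0, open J, is_interval J
    & forall t, J t ->
        is_derive t (1 : R) (fun s => vsval (z s))
          (bracket (vsval (z t)) (vsval ((Phi^-1)%VF (z t))))].

Definition maximal_geodesic (R : realType) (Phi : 'End(sl2 R))
    (J : set R) (z : R -> sl2 R) : Prop :=
  geodesic_on Phi J z /\
  forall (J' : set R) (z' : R -> sl2 R),
    geodesic_on Phi J' z' -> J `<=` J' -> {in J, z =1 z'} -> J' = J.

Definition lies_over (R : realType) (P : {vspace sl2 R})
    (J : set R) (z : R -> sl2 R) : Prop :=
  forall t, J t -> z t \in P.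

Definition invariant_plane (R : realType) (Phi : 'End(sl2 R))
    (P : {vspace sl2 R}) : Prop :=
  \dim P = 2%N /\
  forall (J : set R) (z : R -> sl2 R), maximal_geodesic Phi J z ->
    forall t0, J t0 -> z t0 \in P -> lies_over P J z.

Definition complete_domain (R : realType) (J : set R) : Prop := J = setT.

Definition Rplus_complete_domain (R : realType) (J : set R) : Prop := ~ has_ubound J.

Definition Rminus_complete_domain (R : realType) (J : set R) : Prop := ~ has_lbound J.

Definition finite_domain (R : realType) (J : set R) : Prop :=
  exists a b : R, a < b /\ J = `]a, b[%classic.

(* Main.v *)
(* Let [Z = X + i Y] be a complex eigenvector of [Phi^-1] and [N = [X, Y]], an
   eigenvector for the real eigenvalue. Self-adjointness gives
   [B(Y, Y) = - B(X, X)], so that rescaling [Z] by a complex number, which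
   multiplies [B(X, X) + i B(X, Y)] by its square, normalises both numbers at
   once. For the right normalisation, the equation reads
     [u' = w u, v' = - w v, w' = - (u^2 + v^2)]
   in the coordinates along [X], [Y] and a multiple of [N]. The planes are
   [v = 0] and [u = 0]. In the first one [u^2 + w^2] is conserved and the
   solutions are explicit; in the second one the origin is a fixed point and
   [(0, 1 / cos t, - tan t)] blows up at both ends. Elsewhere [u v] is a nonzero
   constant and [w^2 + u^2 - v^2] is conserved, which forces
   [- w' >= e (1 + w^2)] with [e > 0], hence a bounded interval of definition. *)
Require Import Defs.
From HB Require Import structures.
From mathcomp Require Import all_boot all_order all_algebra.
From mathcomp Require Import all_classical all_reals all_analysis.
From mathcomp Require Import complex.
From mathcomp Require Import ring lra.

Set Implicit Arguments.
Unset Strict Implicit.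
Unset Printing Implicit Defensive.

Import Order.TTheory GRing.Theory Num.Theory.
Import numFieldNormedType.Exports.
Import passmx.

Local Open Scope classical_set_scope.
Local Open Scope ring_scope.

(** * Calculus on an interval: mean values and zeros of solutions of linear equations *)

Lemma open_itv_finite_domain (R : realType) (J : set R) :
  J !=set0 -> open J -> is_interval J -> has_ubound J -> has_lbound J ->
  finite_domain J.
Proof.
move=> [x Jx] oJ iJ uJ lJ.
have JE : J = `]inf J, sup J[%classic.
  by rewrite -[LHS](interior_id J).1// interval_bounded_interior.
exists (inf J), (sup J); split=> //.
by move: Jx; rewrite {1}JE /= in_itv/= => /andP[ax xb]; exact: lt_trans ax xb.
Qed.

Lemma is_interval_MVT (R : realType) (J : set R) (f df : R -> R) (a b : R) :
  is_interval J -> (forall t, J t -> is_derive t 1 f (df t)) ->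
  J a -> J b -> a < b -> exists2 c, J c & f b - f a = df c * (b - a).
Proof.
move=> iJ dfJ Ja Jb ab.
have subJ c : c \in `[a, b] -> J c.
  by rewrite in_itv/=; exact: (iJ a b).
have [c cab fE] : exists2 c, c \in `]a, b[ & f b - f a = df c * (b - a).
  apply: MVT => // [c cab|].
    by apply: dfJ; apply: subJ; exact: subset_itv_oo_cc.
  apply: derivable_within_continuous => c cab.
  by have [] := dfJ c (subJ c cab).
by exists c => //; apply: subJ; exact: subset_itv_oo_cc.
Qed.

Lemma is_interval_cst (R : realType) (J : set R) (f : R -> R) (a b : R) :
  is_interval J -> (forall t, J t -> is_derive t 1 f 0) ->
  J a -> J b -> f a = f b.
Proof.
move=> iJ df Ja Jb.
wlog ab : a b Ja Jb / a < b.
  by move=> H; case: (ltgtP a b) => [/H->//|/H->//|->].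
have [c _ /eqP] := is_interval_MVT iJ df Ja Jb ab.
by rewrite mul0r subr_eq0 => /eqP.
Qed.

(* Gronwall: [f ^ 2 * exp (- 2 C s)] is nonincreasing when [C] bounds [g]. *)
Lemma linear_ode_eq0_right (R : realType) (J : set R) (f g : R -> R) (a b : R) :
  is_interval J -> (forall t, J t -> is_derive t 1 f (g t * f t)) ->
  (forall t, J t -> {for t, continuous g}) ->
  J a -> J b -> a < b -> f a = 0 -> f b = 0.
Proof.
move=> iJ df cg Ja Jb ab fa0.
have subJ c : c \in `[a, b] -> J c by rewrite in_itv/=; exact: (iJ a b).
have [m _ gm] : exists2 c, c \in `[a, b] & forall t, t \in `[a, b] -> g t <= g c.
  apply: EVT_max; first exact: ltW.
  apply: continuous_in_subspaceT => c; rewrite inE/= => cab.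
  by apply: cg; exact: subJ.
set C := g m in gm.
pose h s := f s ^+ 2 * expR (- (2 * C) * s).
have iI : is_interval `[a, b]%classic by exact: interval_is_interval.
have dh t : `[a, b]%classic t ->
    is_derive t 1 h (2 * (g t - C) * h t).
  move=> /subJ Jt; have dft := df _ Jt.
  have de : is_derive t 1 (expR \o ( *%R (- (2 * C))))
      (expR (- (2 * C) * t) * (- (2 * C))).
    apply: is_derive1_comp.
    by apply: is_derive_eq (is_deriveZ _ (is_derive_id t 1)) _; rewrite scaler1.
  apply: is_derive_eq (is_deriveM (is_deriveX 2 dft) de) _.
  by rewrite /h /= /GRing.scale/= expr1 !fctE; ring.
have Ia : `[a, b]%classic a by rewrite /= in_itv/= lexx ltW.
have Ib : `[a, b]%classic b by rewrite /= in_itv/= lexx ltW.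
have [c Ic] := is_interval_MVT iI dh Ia Ib ab.
rewrite {2}/h fa0 expr0n mul0r subr0 => hb.
have : h b <= 0.
  rewrite hb -mulrA -mulrA pmulr_rle0// mulr_le0_ge0//.
    by rewrite subr_le0; exact: gm.
  apply: mulr_ge0; last by rewrite subr_ge0 ltW.
  by rewrite mulr_ge0 ?sqr_ge0 ?expR_ge0.
rewrite /h pmulr_lle0 ?expR_gt0// => fb.
by apply/eqP; rewrite -sqrf_eq0 eq_le fb sqr_ge0.
Qed.

Lemma linear_ode_eq0 (R : realType) (J : set R) (f g : R -> R) (a b : R) :
  is_interval J -> (forall t, J t -> is_derive t 1 f (g t * f t)) ->
  (forall t, J t -> {for t, continuous g}) ->
  J a -> J b -> f a = 0 -> f b = 0.
Proof.
move=> iJ df cg Ja Jb fa0.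
have [ab|ba|<-//] := ltgtP a b.
  exact: (@linear_ode_eq0_right R J f g a b).
(* For [b < a], reverse time: [s => f (- s)] solves the linear equation with coefficient [- g (- s)]
   on the reflected interval. *)
pose J' : set R := -%R @^-1` J.
have JN c : J c -> J' (- c) by rewrite /J'/= opprK.
have dN (t : R) : is_derive t (1 : R) (-%R : R -> R) (-1) by exact: is_deriveNid.
rewrite -[b]opprK.
apply: (@linear_ode_eq0_right R J' (f \o -%R) (fun s => - g (- s)) (- a) (- b));
  rewrite ?ltrN2//=; first last.
- by rewrite opprK.
- exact: JN.
- exact: JN.
- move=> t /= J't; apply: (@continuousN _ _ _ (g \o -%R)).
  apply: continuous_comp; first exact: oppr_continuous.
  exact: cg.
- move=> t J't; have /= dft := df _ J't.
  by apply: is_derive_eq (is_derive1_comp dft (dN t)) _; rewrite mulrN1 mulNr.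
- move=> x y /= Jx Jy z /andP[xz zy].
  by apply: (iJ _ _ Jy Jx); rewrite !lerN2 zy xz.
Qed.

(** * The reduced system: first integrals, blow-up and explicit solutions *)

(* The Euler-Arnold equation in the coordinates provided by
   [euler_arnold_normal_form]. *)
Definition reduced_solution (R : realType) (J : set R) (u v w : R -> R) :=
  forall t, J t ->
    [/\ is_derive t (1 : R) u (w t * u t), is_derive t (1 : R) v (- (w t * v t))
      & is_derive t (1 : R) w (- (u t ^+ 2 + v t ^+ 2))].

Lemma reduced_solution_u_eq0 (R : realType) (J : set R) (u v w : R -> R) a b :
  is_interval J -> reduced_solution J u v w ->
  J a -> J b -> u a = 0 -> u b = 0.
Proof.
move=> iJ sol; apply: (@linear_ode_eq0 _ J _ w) => // t Jt.
  by have [] := sol t Jt.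
have [_ _ [dw _]] := sol t Jt.
exact/differentiable_continuous/derivable1_diffP.
Qed.

Lemma reduced_solution_v_eq0 (R : realType) (J : set R) (u v w : R -> R) a b :
  is_interval J -> reduced_solution J u v w ->
  J a -> J b -> v a = 0 -> v b = 0.
Proof.
move=> iJ sol; apply: (@linear_ode_eq0 _ J _ (- w)) => // t Jt.
  by rewrite fctE mulNr; have [] := sol t Jt.
apply: continuousN; have [_ _ [dw _]] := sol t Jt.
exact/differentiable_continuous/derivable1_diffP.
Qed.

(** The derivative is [- 2 w (u^2 + v^2) + 2 w u^2 + 2 w v^2 = 0]. In the coordinates of
    [euler_arnold_normal_form], this quantity and [u v] span the same quadratic forms as the
    invariants [B(z, z)] and [B(z, Phi^-1 z)] of the Lax equation. *)
Lemma reduced_solution_energy (R : realType) (J : set R) (u v w : R -> R) a b :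
  is_interval J -> reduced_solution J u v w -> J a -> J b ->
  w a ^+ 2 + u a ^+ 2 - v a ^+ 2 = w b ^+ 2 + u b ^+ 2 - v b ^+ 2.
Proof.
move=> iJ sol; apply: (@is_interval_cst _ J (w ^+ 2 + u ^+ 2 - v ^+ 2)) => //.
move=> t /sol[du dv dw]; apply: is_derive_eq.
by rewrite /GRing.scale/= !expr1; ring.
Qed.

Lemma reduced_solution_uv (R : realType) (J : set R) (u v w : R -> R) a b :
  is_interval J -> reduced_solution J u v w -> J a -> J b ->
  u a * v a = u b * v b.
Proof.
move=> iJ sol; apply: (@is_interval_cst _ J (u * v)) => //.
move=> t /sol[du dv dw]; apply: is_derive_eq.
by rewrite /GRing.scale/=; ring.
Qed.

(* By Riccati's inequality [- w' >= e (1 + w ^ 2)], where [2 |u v|] and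
   [w ^ 2 - E] both bound [- w'] from below; hence [atan w + e t] is
   nonincreasing. *)
Lemma reduced_solution_bounded (R : realType) (J : set R) (u v w : R -> R) a :
  is_interval J -> reduced_solution J u v w -> J a ->
  u a != 0 -> v a != 0 -> has_ubound J /\ has_lbound J.
Proof.
move=> iJ sol Ja ua va.
pose m := 2 * `|u a * v a|.
pose E := `|w a ^+ 2 + u a ^+ 2 - v a ^+ 2|.
have m0 : 0 < m by rewrite mulr_gt0// normr_gt0 mulf_neq0.
have E0 : 0 <= E by exact: normr_ge0.
(* With [S = u^2 + v^2], the bounds [m <= S] and [w^2 - E <= S], weighted by [1 + E] and [m], add up
   to [m (1 + w^2) <= (1 + E + m) S]. *)
pose e := m / (1 + E + m).
have D0 : 0 < 1 + E + m by lra.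
have e0 : 0 < e by rewrite divr_gt0.
have riccati t : J t -> e * (1 + w t ^+ 2) <= u t ^+ 2 + v t ^+ 2.
  move=> Jt; set S := u t ^+ 2 + v t ^+ 2.
  have mS : m <= S.
    rewrite /m (reduced_solution_uv iJ sol Ja Jt) normrM /S.
    rewrite -[u t ^+ 2]real_normK ?num_real// -[v t ^+ 2]real_normK ?num_real//.
    by have := sqr_ge0 (`|u t| - `|v t|); nra.
  have wS : w t ^+ 2 - E <= S.
    have : w t ^+ 2 + u t ^+ 2 - v t ^+ 2 <= E.
      by rewrite (reduced_solution_energy iJ sol Jt Ja) /E ler_norm.
    by rewrite /S; have := sqr_ge0 (u t); lra.
  rewrite /e mulrAC ler_pdivrMr//.
  by have := sqr_ge0 (w t); nra.
pose h t := atan (w t) + e * t.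
have dh t : J t ->
    is_derive t 1 h (e - (1 + w t ^+ 2)^-1 * (u t ^+ 2 + v t ^+ 2)).
  move=> /sol[_ _ dw].
  have da : is_derive t 1 (atan \o w) _ := is_derive1_comp (is_derive1_atan _) dw.
  apply: is_derive_eq (is_deriveD da (is_deriveZ e (is_derive_id t 1))) _.
  by rewrite /GRing.scale/=; ring.
(* The total variation available to [atan w] is less than [pi], so two points of [J] are at distance
   at most [pi / e]. *)
have len s t : J s -> J t -> s < t -> e * (t - s) <= pi.
  move=> Js Jt st; have [c Jc hE] := is_interval_MVT iJ dh Js Jt st.
  have : h t - h s <= 0.
    rewrite hE mulr_le0_ge0 ?subr_ge0 ?(ltW st)// subr_le0 mulrC ler_pdivlMr.
      exact: riccati.
    by rewrite ltr_pwDl ?sqr_ge0.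
  rewrite /h; have := atan_gtNpi2 (w t); have := atan_ltpi2 (w s).
  by lra.
have pe : 0 <= pi / e by rewrite divr_ge0 ?pi_ge0// ltW.
split.
  exists (a + pi / e) => t Jt; have [ta|at_] := leP t a.
    by rewrite (le_trans ta)// lerDl.
  by rewrite -lerBlDl ler_pdivlMr// mulrC; exact: len.
exists (a - pi / e) => t Jt; have [at_|ta] := leP a t.
  by apply: le_trans at_; rewrite gerBl.
by rewrite lerBlDl -lerBlDr ler_pdivlMr// mulrC; exact: len.
Qed.

(* With [k ^ 2 = u ^ 2 + w ^ 2] conserved, [y := (k + w) / u] satisfies
   [y' = - k y], and it parametrises the circle of radius [k] rationally. *)
Lemma reduced_solution_extension (R : realType) (J : set R) (u v w : R -> R) :
  J !=set0 -> is_interval J -> reduced_solution J u v w ->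
  (forall t, J t -> v t = 0) ->
  exists u' w', reduced_solution setT u' (fun=> 0) w' /\
    forall t, J t -> u' t = u t /\ w' t = w t.
Proof.
(* If [u] vanishes once, it vanishes throughout; then [w' = 0] and the solution is constant.
   Otherwise the quotient [(k + w) / u] is defined on all of [J]. *)
move=> [a Ja] iJ sol v0; have [ua0|ua0] := eqVneq (u a) 0.
  have u0 t : J t -> u t = 0.
    by move=> Jt; exact: (reduced_solution_u_eq0 iJ sol Ja Jt).
  exists (fun=> 0), (fun=> w a); split=> [t _|t Jt].
    rewrite mulr0 oppr0 expr0n/= addr0 oppr0.
    by split; exact: is_derive_cst.
  rewrite u0//; split=> //; apply: (is_interval_cst iJ _ Ja Jt) => s Js.
  have [_ _] := sol s Js.
  by rewrite u0// v0// expr0n/= addr0 oppr0.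
have u0 t : J t -> u t != 0.
  move=> Jt; apply: contra_neq ua0 => ut0.
  exact: (reduced_solution_u_eq0 iJ sol Jt Ja).
have [k k0 kE] : exists2 k, 0 < k &
    forall t, J t -> k ^+ 2 = w t ^+ 2 + u t ^+ 2.
  exists (Num.sqrt (w a ^+ 2 + u a ^+ 2)) => [|t Jt].
    by rewrite sqrtr_gt0 ltr_wpDl ?sqr_ge0// exprn_even_gt0.
  rewrite sqr_sqrtr ?addr_ge0 ?sqr_ge0//.
  have := reduced_solution_energy iJ sol Ja Jt.
  by rewrite !v0// expr0n/= !subr0.
(* Chosen so that [y a = (k + w a) / u a]. The equality [yE] on all of [J] follows because
   [(k + w) / u * exp (k s)] is constant. *)
pose c := (k + w a) / u a * expR (k * a).
pose y t := c * expR (- k * t).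
have dexp l t : is_derive t (1 : R) (fun s => expR (l * s)) (l * expR (l * t)).
  have dl : is_derive t (1 : R) ( *%R l) l.
    by apply: is_derive_eq (is_deriveZ _ (is_derive_id t 1)) _; rewrite scaler1.
  by apply: is_derive_eq (is_derive1_comp (is_derive_expR _) dl) _; rewrite mulrC.
have dy t : is_derive t (1 : R) y (- k * y t).
  apply: is_derive_eq (is_deriveZ c (dexp (- k) t)) _.
  by rewrite /y /GRing.scale/=; ring.
have yE t : J t -> y t = (k + w t) / u t.
  move=> Jt; pose g s := (k + w s) / u s * expR (k * s).
  have gE : g a = g t.
    apply: (is_interval_cst iJ _ Ja Jt) => s Js.
    have [du _ dw] := sol s Js; have us0 := u0 s Js.
    have dq := is_deriveM (is_deriveD (is_derive_cst k s (1 : R)) dw)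
      (is_deriveV us0 du).
    apply: is_derive_eq (is_deriveM dq (dexp k s)) _.
    rewrite v0// expr0n/= addr0.
    have ks := kE s Js.
    change ((k + w s) / u s * (k * expR (k * s)) + expR (k * s) *
      ((k + w s) * (- u s ^- 2 * (w s * u s)) + (u s)^-1 * (0 - u s ^+ 2)) = 0).
    by field: ks.
  by rewrite /y /c -/(g a) gE /g -mulrA -expRD mulNr addrN expR0 mulr1.
have y1 t : 1 + y t ^+ 2 != 0.
  by rewrite gt_eqF// ltr_pwDl ?sqr_ge0.
(* Obtained by solving [y = (k + w) / u] and [u^2 + w^2 = k^2] for [u] and [w]; as [y] is an
   exponential, the formulas make sense for every real [t]. *)
exists (fun t => 2 * k * y t / (1 + y t ^+ 2)),
  (fun t => k * (y t ^+ 2 - 1) / (1 + y t ^+ 2)); split=> [t _|t Jt].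
  have dD := is_deriveV (y1 t : (cst 1 + y ^+ 2) t != 0)
    (is_deriveD (is_derive_cst (1 : R) t (1 : R)) (is_deriveX 2 (dy t))).
  split.
  - apply: is_derive_eq (is_deriveM (is_deriveZ (2 * k) (dy t)) dD) _.
    change ((2 * k * y t) *
      (- (1 + y t ^+ 2) ^- 2 * (0 + 2 * y t ^+ 1 * (- k * y t)))
      + (1 + y t ^+ 2)^-1 * (2 * k * (- k * y t)) =
      k * (y t ^+ 2 - 1) / (1 + y t ^+ 2) * (2 * k * y t / (1 + y t ^+ 2))).
    by field; exact: y1.
  - by rewrite mulr0 oppr0; exact: is_derive_cst.
  - apply: is_derive_eq (is_deriveM (is_deriveZ k
      (is_deriveB (is_deriveX 2 (dy t)) (is_derive_cst (1 : R) t (1 : R)))) dD) _.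
    change (k * (y t ^+ 2 - 1) *
      (- (1 + y t ^+ 2) ^- 2 * (0 + 2 * y t ^+ 1 * (- k * y t)))
      + (1 + y t ^+ 2)^-1 * (k * (2 * y t ^+ 1 * (- k * y t) - 0)) =
      - ((2 * k * y t / (1 + y t ^+ 2)) ^+ 2 + 0 ^+ 2)).
    by field; exact: y1.
have ut0 := u0 t Jt; have ks := kE t Jt.
have y1t := y1 t; rewrite yE// in y1t *.
have yD : 1 + ((k + w t) / u t) ^+ 2 = 2 * k * (k + w t) / u t ^+ 2.
  by field: ks.
have kw : k + w t != 0.
  by apply: contra_neq y1t => kw0; rewrite yD kw0 mulr0 mul0r.
have kn0 : k != 0 by rewrite gt_eqF.
rewrite yD; split; first by field; rewrite kw kn0 ut0.
have -> : ((k + w t) / u t) ^+ 2 - 1 = 2 * w t * (k + w t) / u t ^+ 2.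
  by field: ks.
by field; rewrite kw kn0 ut0.
Qed.

Lemma reduced_solution_tan (R : realType) :
  reduced_solution `](- (pi / 2)), (pi / 2)[%classic
    (fun=> 0 : R) (fun t => (cos t)^-1) (fun t => - tan t).
Proof.
move=> t; rewrite /= in_itv/= => tpi.
have c0 : cos t != 0 by rewrite gt_eqF// cos_gt0_pihalf.
rewrite mulr0; split; first exact: is_derive_cst.
- apply: is_derive_eq (is_deriveV c0 (is_derive_cos t)) _.
  rewrite /tan /GRing.scale/=; field.
  exact: c0.
- rewrite expr0n/= add0r exprVn.
  exact: is_deriveN (is_derive_tan c0).
Qed.

(* [f := w cos + sin] satisfies [f' = - w f]: a solution extending
   [(0, 1 / cos, - tan)] cannot reach a zero of [cos]. *)
Lemma reduced_solution_cos_neq0 (R : realType) (J : set R) (u v w : R -> R) a :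
  is_interval J -> reduced_solution J u v w -> J 0 ->
  u 0 = 0 -> v 0 = 1 -> w 0 = 0 -> J a -> cos a != 0.
Proof.
move=> iJ sol J0 u0 v0 w0 Ja.
pose f := w * cos + sin.
have fa0 : f a = 0.
  apply: (@linear_ode_eq0 _ J f (- w) 0 a iJ _ _ J0 Ja) => [t Jt|t Jt|].
  - have [_ _ dw] := sol t Jt.
    apply: is_derive_eq
      (is_deriveD (is_deriveM dw (is_derive_cos t)) (is_derive_sin t)) _.
    have := reduced_solution_energy iJ sol J0 Jt.
    rewrite (reduced_solution_u_eq0 iJ sol J0 Jt u0) u0 v0 w0 => e.
    (* The energy is [-1] and [u = 0]. *)
    have vE : v t ^+ 2 = w t ^+ 2 + 1 by lra.
    change (w t * - sin t + cos t * - (0 ^+ 2 + v t ^+ 2) + cos t =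
      - w t * (w t * cos t + sin t)).
    by rewrite vE; ring.
  - apply: continuousN; have [_ _ [dw _]] := sol t Jt.
    exact/differentiable_continuous/derivable1_diffP.
  - by rewrite /f !fctE w0 sin0 mul0r addr0.
(* At a zero of [cos], [f] equals [sin], whose square is 1 there. *)
apply: contra_eq_neq fa0 => ca; rewrite /f !fctE ca mulr0 add0r.
have := cos2Dsin2 a; rewrite ca expr0n/= add0r => /eqP.
by apply: contraTneq => ->; rewrite expr0n/= eq_sym oner_neq0.
Qed.

(** * Bracket and form on sl(2,R), computed entrywise *)

Lemma sl2v_mem (R : realType) (M : 'M[R]_2) : (M \in sl2v R) = (\tr M == 0).
Proof. by rewrite memv_ker lfunE. Qed.

Lemma sl2_val11 (R : realType) (x : sl2 R) : vsval x 1 1 = - vsval x 0 0.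
Proof.
have := subvsP x; rewrite sl2v_mem /mxtrace big_ord_recl big_ord1 => /eqP.
rewrite (_ : lift ord0 ord0 = 1); last exact: val_inj.
by move=> /eqP; rewrite addrC addr_eq0 => /eqP.
Qed.

Lemma sl2_eq (R : realType) (x y : sl2 R) :
  vsval x 0 0 = vsval y 0 0 -> vsval x 0 1 = vsval y 0 1 ->
  vsval x 1 0 = vsval y 1 0 -> x = y.
Proof.
move=> e00 e01 e10; apply: val_inj; apply/matrixP => i j.
have ord2 (k : 'I_2) : k = 0 \/ k = 1.
  by case: k => -[|[|//]] ?; [left|right]; exact: val_inj.
by case: (ord2 i) (ord2 j) => -> [] ->; rewrite ?sl2_val11 ?e00.
Qed.

(* [ring] is very slow at telling apart the atoms [M 0 0] and [M 0 1]. *)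
Ltac generalize_entries :=
  repeat match goal with
  | |- context [@fun_of_matrix ?A ?m ?n ?M ?i ?j] =>
      generalize (@fun_of_matrix A m n M i j); intro
  end.

(** The projection [vsproj] leaves the commutator unchanged, since its trace is zero; it only makes
    the bracket an element of [sl2 R]. *)
Definition lie (R : realType) (x y : sl2 R) : sl2 R :=
  vsproj (sl2v R) (bracket (vsval x) (vsval y)).

Lemma vsval_lie (R : realType) (x y : sl2 R) :
  vsval (lie x y) = bracket (vsval x) (vsval y).
Proof. by rewrite vsprojK// sl2v_mem /bracket linearB/= mxtrace_mulC subrr. Qed.

Lemma mul2mxE (R : realType) (x y : 'M[R]_2) i j :
  (x *m y) i j = x i 0 * y 0 j + x i 1 * y 1 j.
Proof.
rewrite mxE big_ord_recl big_ord1; congr (_ + _ * _); congr (_ _ _);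
  exact: val_inj.
Qed.

Lemma lieE (R : realType) (x y : sl2 R) :
  (vsval (lie x y) 0 0 = vsval x 0 1 * vsval y 1 0 - vsval x 1 0 * vsval y 0 1) *
  (vsval (lie x y) 0 1 = 2 * (vsval x 0 0 * vsval y 0 1 - vsval x 0 1 * vsval y 0 0)) *
  (vsval (lie x y) 1 0 = 2 * (vsval x 1 0 * vsval y 0 0 - vsval x 0 0 * vsval y 1 0)).
Proof.
rewrite vsval_lie.
have brE (X Y : 'M[R]_2) i j :
    bracket X Y i j = (X *m Y) i j - (Y *m X) i j by rewrite !mxE.
by rewrite !brE !mul2mxE !sl2_val11; do !split; ring.
Qed.

Lemma BE (R : realType) (x y : sl2 R) :
  B x y = 2 * (2 * vsval x 0 0 * vsval y 0 0 + vsval x 0 1 * vsval y 1 0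
               + vsval x 1 0 * vsval y 0 1).
Proof.
rewrite /B /mxtrace big_ord_recl big_ord1.
rewrite (_ : lift ord0 ord0 = 1); last exact: val_inj.
by rewrite !mul2mxE !sl2_val11; ring.
Qed.

Lemma sl2_linE (R : realType) :
  (forall (x y : sl2 R) i j, vsval (x + y) i j = vsval x i j + vsval y i j) *
  (forall (x : sl2 R) i j, vsval (- x) i j = - vsval x i j) *
  (forall (a : R) (x : sl2 R) i j, vsval (a *: x) i j = a * vsval x i j).
Proof.
split; [split=> [x y|x] i j|move=> a x i j].
- by rewrite linearD mxE.
- by rewrite linearN mxE.
- by rewrite linearZ mxE.
Qed.

Lemma sl2_combE (R : realType) (a b c : R) (x y z : sl2 R) i j :
  vsval (a *: x + b *: y + c *: z) i j =
  a * vsval x i j + b * vsval y i j + c * vsval z i j.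
Proof. by rewrite !sl2_linE. Qed.

Lemma B_sym (R : realType) (x y : sl2 R) : B x y = B y x.
Proof. by rewrite !BE; generalize_entries; ring. Qed.

Lemma B_comb3 (R : realType) (a b c : R) (x y z t : sl2 R) :
  B (a *: x + b *: y + c *: z) t = a * B x t + b * B y t + c * B z t.
Proof. by rewrite !BE !sl2_combE; generalize_entries; ring. Qed.

Lemma B_comb2 (R : realType) (a b : R) (x y t : sl2 R) :
  B (a *: x + b *: y) t = a * B x t + b * B y t.
Proof.
by have := B_comb3 a b 0 x y 0 t; rewrite scale0r addr0 mul0r addr0.
Qed.

Lemma B_liel (R : realType) (x y : sl2 R) : B (lie x y) x = 0.
Proof. by rewrite BE !lieE; generalize_entries; ring. Qed.

Lemma B_lier (R : realType) (x y : sl2 R) : B (lie x y) y = 0.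
Proof. by rewrite BE !lieE; generalize_entries; ring. Qed.

(** The bracket is a cross product for the indefinite form [B]: this is the Lagrange identity and
    [lie_lie] is the triple product formula, both with the sign opposite to the Euclidean one. *)
Lemma B_lie_lie (R : realType) (x y : sl2 R) :
  B (lie x y) (lie x y) = B x y ^+ 2 - B x x * B y y.
Proof. by rewrite !BE !lieE; generalize_entries; ring. Qed.

Lemma lie_lie (R : realType) (x y z : sl2 R) :
  lie x (lie y z) = B x y *: z - B x z *: y.
Proof. by apply: sl2_eq; rewrite !lieE !sl2_linE !BE; generalize_entries; ring. Qed.

Lemma lie_comb (R : realType) (a b c a' b' c' : R) (x y z : sl2 R) :
  lie (a *: x + b *: y + c *: z) (a' *: x + b' *: y + c' *: z) =
  (a * b' - b * a') *: lie x y + (a * c' - c * a') *: lie x z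
  + (b * c' - c * b') *: lie y z.
Proof.
move: (lie x y) (lieE x y) (lie x z) (lieE x z) (lie y z) (lieE y z).
move=> xy xyE xz xzE yz yzE.
have := sl2_combE (a * b' - b * a') (a * c' - c * a') (b * c' - c * b') xy xz yz.
move: (_ + _ *: yz) => s sE.
have := sl2_combE a b c x y z; move: (a *: x + _ + _) => t tE.
have := sl2_combE a' b' c' x y z; move: (a' *: x + _ + _) => t' t'E.
by apply: sl2_eq; rewrite lieE sE !tE !t'E ?xyE ?xzE ?yzE; generalize_entries; ring.
Qed.

(** Rank-nullity for the trace, which does not vanish on [delta_mx 0 0]. The bound turns three free
    vectors into a basis. *)
Lemma dim_sl2_le3 (R : realType) : (\dim {: sl2 R} <= 3)%N.
Proof.
rewrite dimvf [leqLHS]/(\dim (sl2v R)).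
pose tr : 'Hom('M[R]_2, R^o) := linfun (@mxtrace R 2).
have dimE : (\dim (sl2v R) + \dim (limg tr) = 4)%N.
  by rewrite -[sl2v R]capfv limg_ker_dim dimvf dim_matrix.
have : (0 < \dim (limg tr))%N.
  rewrite lt0n dimv_eq0; apply: contraTneq isT => img0.
  have : tr (delta_mx 0 0) \in 0%VS.
    by rewrite -img0 memv_img// memvf.
  rewrite memv0 lfunE/= /mxtrace big_ord_recl big_ord1 !mxE/= addr0.
  by rewrite oner_eq0.
by move=> i0; rewrite -ltnS -[ltnRHS]dimE -[ltnLHS]addn0 ltn_add2l.
Qed.

(** On symmetric traceless matrices [B] is positive definite: [B x x] is four times the sum of the
    squares of the two free entries. *)
Lemma B_isotropic_eq0 (R : realType) (x : sl2 R) :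
  B x x = 0 -> vsval x 0 1 = vsval x 1 0 -> x = 0.
Proof.
rewrite BE => + e; rewrite e => Bxx.
have x0_ge0 := sqr_ge0 (vsval x 0 0); have x1_ge0 := sqr_ge0 (vsval x 1 0).
have xx : vsval x 0 0 ^+ 2 = 0 by nra.
have yy : vsval x 1 0 ^+ 2 = 0 by nra.
move/eqP: xx; rewrite sqrf_eq0 => /eqP xx.
move/eqP: yy; rewrite sqrf_eq0 => /eqP yy.
by apply: sl2_eq; rewrite ?e ?xx ?yy mxE.
Qed.

(** * From a complex eigenvector to the normal form of the equation *)

(** [X] and [Y] are the real and imaginary parts of a complex row eigenvector [z]; the matrix of
    [Phi] is real, so both parts of the eigenvalue equation can be read separately. *)
Lemma complex_eigenvector (R : realType) (Phi : 'End(sl2 R)) (l : R[i]) :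
  complex_eigenvalue Phi l ->
  exists X Y : sl2 R, [/\ X != 0 \/ Y != 0,
    Phi X = complex.Re l *: X + - complex.Im l *: Y
    & Phi Y = complex.Im l *: X + complex.Re l *: Y].
Proof.
set e := vbasis {: sl2 R} => /eigenvalueP[z zE z0].
have be : basis_of {: sl2 R} e by exact: vbasisP.
pose X := map_mx (@complex.Re R) z; pose Y := map_mx (@complex.Im R) z.
set M := mxof e e Phi in zE.
have XM : X *m M = complex.Re l *: X - complex.Im l *: Y.
  apply/rowP => j; have := congr1 (fun A : 'rV_ _ => complex.Re (A 0 j)) zE.
  rewrite !mxE raddf_sum /= => zj.
  transitivity (\sum_i complex.Re (z 0 i * map_mx (real_complex R) M i j)).
    apply: eq_bigr => i _; rewrite !mxE; case: (z 0 i) => a b /=.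
    by rewrite mulr0 subr0.
  rewrite zj; case: l {zE zj} => a b /=; case: (z 0 j) => c d /=.
  by [].
have YM : Y *m M = complex.Im l *: X + complex.Re l *: Y.
  apply/rowP => j; have := congr1 (fun A : 'rV_ _ => complex.Im (A 0 j)) zE.
  rewrite !mxE raddf_sum /= => zj.
  transitivity (\sum_i complex.Im (z 0 i * map_mx (real_complex R) M i j)).
    apply: eq_bigr => i _; rewrite !mxE; case: (z 0 i) => a b /=.
    by rewrite mulr0 add0r mulrC.
  rewrite zj; case: l {zE zj XM} => a b /=; case: (z 0 j) => c d /=.
  by rewrite addrC.
exists (vecof e X), (passmx.vecof e Y); split.
- rewrite !vecof_eq0//.
  have [X0|] := eqVneq X 0; [right|by left].
  apply: contraNneq z0 => Y0; apply/eqP/rowP => j; rewrite mxE.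
  have := congr1 (fun A : 'rV_ _ => A 0 j) X0.
  have := congr1 (fun A : 'rV_ _ => A 0 j) Y0.
  by rewrite !mxE; case: (z 0 j) => a b /= -> ->.
- by rewrite (hom_vecof e be) -/M XM scaleNr linearB !linearZ.
- by rewrite (hom_vecof e be) -/M YM linearD !linearZ.
Qed.

Lemma lfun_comb (R : realType) (f : 'End(sl2 R)) (a b : R) (x y : sl2 R) :
  f (a *: x + b *: y) = a *: f x + b *: f y.
Proof. by rewrite linearD !linearZ. Qed.

Lemma lfun_scale (R : realType) (f : 'End(sl2 R)) (a : R) (x : sl2 R) :
  f (a *: x) = a *: f x.
Proof. by rewrite linearZ. Qed.

Lemma lin_comb2 (R : realType) (k a b l c d : R) (x y : sl2 R) :
  k *: (a *: x + b *: y) + l *: (c *: x + d *: y) =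
  (k * a + l * c) *: x + (k * b + l * d) *: y.
Proof. by rewrite !scalerDr !scalerA addrACA -!scalerDl. Qed.

Lemma eq_comb2 (R : realType) (a b a' b' : R) (x y : sl2 R) :
  a = a' -> b = b' -> a *: x + b *: y = a' *: x + b' *: y.
Proof. by move=> -> ->. Qed.

Lemma eq_comb3 (R : realType) (a b c a' b' c' : R) (x y z : sl2 R) :
  a = a' -> b = b' -> c = c' ->
  a *: x + b *: y + c *: z = a' *: x + b' *: y + c' *: z.
Proof. by move=> -> -> ->. Qed.

(** On [Z = X + i Y] the inverse acts as multiplication by [1 / l = al - i be]. *)
Lemma complex_eigenvector_inv (R : realType) (Phi : 'End(sl2 R)) (l : R[i]) :
  lker Phi = 0%VS -> complex_eigenvalue Phi l -> complex.Im l != 0 ->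
  exists (al be : R) (X Y : sl2 R), [/\ be != 0, X != 0 \/ Y != 0,
    (Phi^-1)%VF X = al *: X + be *: Y & (Phi^-1)%VF Y = - be *: X + al *: Y].
Proof.
move=> /eqP Phi0 /complex_eigenvector[X [Y [XY0 PhiX PhiY]]].
move: (complex.Re l) (complex.Im l) PhiX PhiY => a b PhiX PhiY b0.
have n0 : a ^+ 2 + b ^+ 2 != 0 by rewrite gt_eqF// ltr_wpDl ?sqr_ge0// exprn_even_gt0.
exists (a / (a ^+ 2 + b ^+ 2)), (b / (a ^+ 2 + b ^+ 2)), X, Y.
split=> //; first by rewrite mulf_neq0// invr_neq0.
- rewrite -[RHS](lker0_lfunK Phi0) lfun_comb PhiX PhiY lin_comb2; congr (_ _).
  transitivity (1 *: X + 0 *: Y); first by rewrite scale1r scale0r addr0.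
  by apply: eq_comb2; field.
- rewrite -[RHS](lker0_lfunK Phi0) lfun_comb PhiX PhiY lin_comb2; congr (_ _).
  transitivity (0 *: X + 1 *: Y); first by rewrite scale0r scale1r add0r.
  by apply: eq_comb2; field.
Qed.

(** [B] has signature (2,1), so a totally isotropic subspace is at most a line, whereas [be != 0]
    makes [X] and [Y] span a plane. *)
Lemma complex_eigenvector_not_isotropic (R : realType) (psi : 'End(sl2 R))
    (al be : R) (X Y : sl2 R) :
  be != 0 -> X != 0 \/ Y != 0 ->
  psi X = al *: X + be *: Y -> psi Y = - be *: X + al *: Y ->
  B X X = 0 -> B X Y = 0 -> B Y Y = 0 -> False.
Proof.
move=> be0 XY0 psiX psiY XX XY YY.
(* [T] is the coordinate along a timelike vector. Isotropy of the plane makes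
   [T Y X - T X Y] vanish, and applying [psi] gives [T X ^ 2 + T Y ^ 2 = 0]. *)
pose T (x : sl2 R) := vsval x 0 1 - vsval x 1 0.
have TD a x b y : T (a *: x + b *: y) = a * T x + b * T y.
  by rewrite /T !linearD !linearZ/= !mxE; ring.
have T_eq0 x : B x x = 0 -> T x = 0 -> x = 0.
  by move=> xx /eqP; rewrite subr_eq0 => /eqP; exact: B_isotropic_eq0.
have parXY : T Y *: X + - T X *: Y = 0.
  apply: T_eq0; last by rewrite TD; ring.
  rewrite B_comb2 !(B_sym _ (_ + _ *: Y)) !B_comb2.
  by rewrite XX (B_sym Y X) XY YY; ring.
have : be *: (T X *: X + T Y *: Y) = 0.
  have := congr1 psi parXY.
  rewrite linear0 lfun_comb psiX psiY lin_comb2 => e.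
  have := lin_comb2 1 (T Y * al + - T X * - be) (T Y * be + - T X * al)
    (- al) (T Y) (- T X) X Y.
  rewrite e parXY !scaler0 addr0 => ->; rewrite scalerDr !scalerA.
  by apply: eq_comb2; ring.
move/eqP; rewrite scaler_eq0 (negPf be0)/= => /eqP/(congr1 T).
rewrite TD [in RHS]/T linear0 !mxE subrr => TT.
have TX : T X = 0 by have := sqr_ge0 (T X); have := sqr_ge0 (T Y); nra.
have TY : T Y = 0 by have := sqr_ge0 (T X); have := sqr_ge0 (T Y); nra.
by case: XY0 => /eqP; apply; exact: T_eq0.
Qed.

(** Here [z0] is half of the complexified [B(Z, Z)] with [Z = X + i Y]. It is nonzero, so a complex
    square root [c] moves it to any target [p + i r] when [Z] becomes [c Z]. The bracket is only
    scaled, by [|c|^2], and so stays on the same line. *)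
Lemma complex_eigenvector_normalized (R : realType) (psi : 'End(sl2 R))
    (al be p r : R) (X Y : sl2 R) :
  (forall x y, B (psi x) y = B x (psi y)) ->
  be != 0 -> X != 0 \/ Y != 0 ->
  psi X = al *: X + be *: Y -> psi Y = - be *: X + al *: Y ->
  exists X' Y' : sl2 R,
  [/\ psi X' = al *: X' + be *: Y', psi Y' = - be *: X' + al *: Y',
      [/\ B X' X' = p, B X' Y' = r & B Y' Y' = - p]
    & exists k : R, lie X' Y' = k *: lie X Y].
Proof.
move=> psiB be0 XY0 psiX psiY.
have YY : B Y Y = - B X X.
  have := psiB X Y; rewrite psiX psiY (B_sym X) !B_comb2 (B_sym Y X) => /eqP.
  rewrite -subr_eq0 (_ : _ - _ = be * (B Y Y + B X X)); last by ring.
  by rewrite mulf_eq0 (negPf be0) addr_eq0 => /eqP.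
pose z0 : R[i] := Complex (B X X) (B X Y).
have z0_neq0 : z0 != 0.
  apply/eqP => -[XX XY].
  apply: (@complex_eigenvector_not_isotropic _ psi al be X Y) => //.
  by rewrite YY XX oppr0.
pose c := sqrtc (Complex p r / z0).
have : c ^+ 2 * z0 = Complex p r by rewrite sqr_sqrtc divfK.
rewrite /z0; case: c => c1 c2; rewrite expr2 => -[pE rE].
exists (c1 *: X + - c2 *: Y), (c2 *: X + c1 *: Y); split.
- by rewrite lfun_comb psiX psiY !lin_comb2; apply: eq_comb2; ring.
- by rewrite lfun_comb psiX psiY !lin_comb2; apply: eq_comb2; ring.
- by split; rewrite B_comb2 !(B_sym _ (_ + _)) !B_comb2 (B_sym Y X) YY -?pE -?rE; ring.
- exists (c1 * c1 + c2 * c2).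
  have := lie_comb c1 (- c2) 0 c2 c1 0 X Y 0; rewrite !scale0r !addr0 => ->.
  rewrite !mul0r !mulr0 !subrr !scale0r !addr0; congr (_ *: _); ring.
Qed.

(** The system is the Gram matrix of [X], [Y], with rows [(p, r)] and [(r, - p)], applied to
    [(a, b)]; its determinant is [- (p^2 + r^2)]. *)
Lemma rotation_eq0 (R : realType) (p r a b : R) :
  p ^+ 2 + r ^+ 2 != 0 -> a * p + b * r = 0 -> a * r - b * p = 0 ->
  a = 0 /\ b = 0.
Proof.
move=> pr0 e1 e2; split; apply: (mulfI pr0); rewrite mulr0.
  by transitivity (p * (a * p + b * r) + r * (a * r - b * p));
    [|rewrite e1 e2]; ring.
by transitivity (r * (a * p + b * r) - p * (a * r - b * p));
  [|rewrite e1 e2]; ring.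
Qed.

(** The bracket is orthogonal to [X] and [Y] and has square [p^2 + r^2], so pairing a linear
    relation with it, then with [X] and [Y], kills the coefficients. *)
Lemma complex_eigenvector_lie_basis (R : realType) (p r c : R) (X Y : sl2 R) :
  p ^+ 2 + r ^+ 2 != 0 -> c != 0 ->
  B X X = p -> B X Y = r -> B Y Y = - p ->
  basis_of fullv [:: X; Y; c *: lie X Y].
Proof.
move=> pr0 c0 XX XY YY; rewrite basisEfree subvf dim_sl2_le3 !andbT.
apply/(@freeP _ _ _ [tuple X; Y; c *: lie X Y]) => k.
rewrite !big_ord_recl big_ord0 addr0 addrA /= scalerA.
set a := k ord0; set b := k _; set d := k _ => kE.
have BkE t : B (a *: X + b *: Y + (d * c) *: lie X Y) t = 0.
  by rewrite kE BE mxE; rewrite !mxE; ring.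
have NN : B (lie X Y) (lie X Y) = p ^+ 2 + r ^+ 2.
  by rewrite B_lie_lie XX XY YY; ring.
have d0 : d = 0.
  have := BkE (lie X Y).
  rewrite B_comb3 !(B_sym _ (lie X Y)) B_liel B_lier NN !mulr0 !add0r => /eqP.
  by rewrite !mulf_eq0 (negPf pr0) (negPf c0) !orbF => /eqP.
have eX : a * p + b * r = 0.
  by have := BkE X; rewrite B_comb3 B_liel (B_sym Y) XX XY mulr0 addr0.
have eY : a * r - b * p = 0.
  by have := BkE Y; rewrite B_comb3 B_lier XY YY mulr0 addr0 mulrN.
have [a0 b0] := rotation_eq0 pr0 eX eY.
case=> -[|[|[|//]]] ilt; [rewrite -a0|rewrite -b0|rewrite -d0];
  by congr (k _); exact: val_inj.
Qed.

(** A self-adjoint map that preserves the span of [X] and [Y] preserves its orthogonal, the line of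
    the bracket. *)
Lemma complex_eigenvector_lie (R : realType) (psi : 'End(sl2 R))
    (al be p r : R) (X Y : sl2 R) :
  (forall x y, B (psi x) y = B x (psi y)) ->
  psi X = al *: X + be *: Y -> psi Y = - be *: X + al *: Y ->
  p ^+ 2 + r ^+ 2 != 0 ->
  B X X = p -> B X Y = r -> B Y Y = - p ->
  exists nu : R, psi (lie X Y) = nu *: lie X Y.
Proof.
move=> psiB psiX psiY pr0 XX XY YY.
have bas := complex_eigenvector_lie_basis pr0 (oner_neq0 R) XX XY YY.
have [u [v [w nE]]] : exists u v w : R,
    psi (lie X Y) = u *: X + v *: Y + w *: lie X Y.
  have := coord_basis (bas : basis_of fullv [tuple X; Y; 1 *: lie X Y])
    (memvf (psi (lie X Y))).
  rewrite !big_ord_recl big_ord0 addr0 addrA /= scale1r => e.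
  by do 3! eexists; exact: e.
have eX : u * p + v * r = 0.
  have := psiB (lie X Y) X; rewrite psiX nE B_comb3 [RHS]B_sym B_comb2.
  by rewrite !(B_sym _ (lie X Y)) B_liel B_lier (B_sym Y) XX XY => e; lra.
have eY : u * r - v * p = 0.
  have := psiB (lie X Y) Y; rewrite psiY nE B_comb3 [RHS]B_sym B_comb2.
  by rewrite !(B_sym _ (lie X Y)) B_liel B_lier XY YY => e; lra.
have [u0 v0] := rotation_eq0 pr0 eX eY.
by exists w; rewrite nE u0 v0 !scale0r !add0r.
Qed.

Lemma euler_arnold_normal_form (R : realType) (Phi : 'End(sl2 R)) (l : R[i]) :
  lker Phi = 0%VS -> (forall x y, B (Phi x) y = B x (Phi y)) ->
  complex_eigenvalue Phi l -> complex.Im l != 0 ->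
  exists f1 f2 f3 : sl2 R, basis_of fullv [:: f1; f2; f3] /\
    forall u v w : R,
      let z := u *: f1 + v *: f2 + w *: f3 in
      lie z ((Phi^-1)%VF z) =
      (w * u) *: f1 + - (w * v) *: f2 + - (u ^+ 2 + v ^+ 2) *: f3.
Proof.
move=> Phi0 PhiB Phil l0.
have PhiK : cancel (Phi^-1)%VF Phi by apply: lker0_lfunVK; apply/eqP.
set psi := (Phi^-1)%VF in PhiK *.
have psiB x y : B (psi x) y = B x (psi y).
  by rewrite -{1}(PhiK y) -PhiB PhiK.
have [al [be [X0 [Y0 [be0 XY0]]]]] := complex_eigenvector_inv Phi0 Phil l0.
rewrite -/psi => psiX0 psiY0.
(* A first normalisation, to [p = 1] and [r = 0], reveals the real eigenvalue [nu], on which the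
   final one depends. *)
have [X1 [Y1 [psiX1 psiY1 [XX1 XY1 YY1] _]]] :=
  complex_eigenvector_normalized 1 0 psiB be0 XY0 psiX0 psiY0.
have pr1 : (1 : R) ^+ 2 + 0 ^+ 2 != 0 by rewrite expr1n expr0n/= addr0 oner_neq0.
have [nu psiN1] := complex_eigenvector_lie psiB psiX1 psiY1 pr1 XX1 XY1 YY1.
have XY10 : X1 != 0 \/ Y1 != 0.
  left; apply: contra_eq_neq XX1 => ->.
  by rewrite BE !mxE !mulr0 !addr0 mulr0 eq_sym oner_neq0.
pose de := nu - al; pose D := be ^+ 2 + de ^+ 2.
have D0 : D != 0.
  by rewrite gt_eqF// ltr_pwDl ?sqr_ge0// exprn_even_gt0.
(* With third vector [- be [X, Y]], the first two components become [w u] and [- w v] exactly when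
   [r be = p de] and [be (p be + r de) = 1]; these are the solutions [p], [r]. *)
have [X [Y [psiX psiY [XX XY YY] [k NE]]]] :=
  complex_eigenvector_normalized D^-1 (de / (be * D)) psiB be0 XY10 psiX1 psiY1.
have psiN : psi (lie X Y) = nu *: lie X Y.
  by rewrite NE linearZ/= psiN1 !scalerA mulrC.
exists X, Y, (- be *: lie X Y); split.
  apply: complex_eigenvector_lie_basis XX XY YY; rewrite ?oppr_eq0//.
  by rewrite gt_eqF// ltr_pwDl ?sqr_ge0// exprn_even_gt0 ?invr_neq0.
move=> u v w /=.
have zE : psi (u *: X + v *: Y + w *: (- be *: lie X Y)) =
    (al * u - be * v) *: X + (be * u + al * v) *: Y
    + (- be * nu * w) *: lie X Y.
  rewrite scalerA linearD/= lfun_scale psiN lfun_comb psiX psiY lin_comb2 scalerA.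
  by apply: eq_comb3; ring.
have XN : lie X (lie X Y) = - (de / (be * D)) *: X + D^-1 *: Y.
  by rewrite lie_lie XX XY scaleNr addrC.
have YN : lie Y (lie X Y) = D^-1 *: X + (de / (be * D)) *: Y.
  by rewrite lie_lie B_sym XY YY scaleNr opprK addrC.
rewrite zE !scalerA lie_comb XN YN -addrA lin_comb2 addrC.
move: D0; rewrite /D /de => D0.
by apply: eq_comb3; field; rewrite ?D0 ?be0.
Qed.

(** * Passing between geodesics and solutions of the reduced system *)

Lemma is_derive_mxP (R : realType) m n (M : R -> 'M[R]_(m.+1, n.+1)) (t : R)
    (D : 'M[R]_(m.+1, n.+1)) :
  is_derive t (1 : R) M D <->
  forall i j, is_derive t (1 : R) (fun s => M s i j) (D i j).
Proof.
split=> [[dM <-] i j|dM].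
  rewrite derive_mx// mxE; apply: DeriveDef => //.
  by move/derivable_mxP : dM; exact.
have dM' : derivable M t 1 by apply/derivable_mxP => i j; have [] := dM i j.
apply: DeriveDef => //; rewrite derive_mx//; apply/matrixP => i j.
by rewrite mxE; have [] := dM i j.
Qed.

Lemma is_derive_scalar_mx (R : realType) m n (g : {scalar 'M[R]_(m.+1, n.+1)})
    (M : R -> 'M[R]_(m.+1, n.+1)) (t : R) (D : 'M[R]_(m.+1, n.+1)) :
  is_derive t (1 : R) M D -> is_derive t (1 : R) (fun s => g (M s)) (g D).
Proof.
move=> /is_derive_mxP dM.
have gE A : g A = \sum_i \sum_j g (delta_mx i j) * A i j.
  rewrite {1}(matrix_sum_delta A) linear_sum; apply: eq_bigr => i _.
  by rewrite linear_sum; apply: eq_bigr => j _; rewrite linearZ/= mulrC.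
rewrite gE.
have -> : (fun s => g (M s)) =
    \sum_i \sum_j (g (delta_mx i j) \*: (fun s => M s i j)).
  apply/funext => s; rewrite gE fct_sumE; apply: eq_bigr => i _.
  by rewrite fct_sumE.
by apply: is_derive_sum => i; apply: is_derive_sum => j; exact: is_deriveZ (dM i j).
Qed.

(** The basis of [euler_arnold_normal_form] together with its dual basis; having the coordinates as
    linear forms lets them be differentiated along a geodesic. *)
Record reduced_frame (R : realType) (Phi : 'End(sl2 R)) := ReducedFrame {
  frame1 : sl2 R; frame2 : sl2 R; frame3 : sl2 R;
  coord1 : {scalar sl2 R}; coord2 : {scalar sl2 R}; coord3 : {scalar sl2 R};
  frame_coordE : forall z,
    z = coord1 z *: frame1 + coord2 z *: frame2 + coord3 z *: frame3;
  coord_frameE : forall a b c : R,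
    let z := a *: frame1 + b *: frame2 + c *: frame3 in
    [/\ coord1 z = a, coord2 z = b & coord3 z = c];
  frame_free : free [:: frame1; frame2; frame3];
  frame_lieE : forall a b c : R,
    let z := a *: frame1 + b *: frame2 + c *: frame3 in
    lie z ((Phi^-1)%VF z) =
    (c * a) *: frame1 + - (c * b) *: frame2 + - (a ^+ 2 + b ^+ 2) *: frame3
}.

Lemma reduced_frame_exists (R : realType) (Phi : 'End(sl2 R)) (l : R[i]) :
  lker Phi = 0%VS -> (forall x y, B (Phi x) y = B x (Phi y)) ->
  complex_eigenvalue Phi l -> complex.Im l != 0 -> inhabited (reduced_frame Phi).
Proof.
move=> Phi0 PhiB Phil l0.
have [f1 [f2 [f3 [bas nf]]]] := euler_arnold_normal_form Phi0 PhiB Phil l0.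
pose X := [tuple f1; f2; f3]; have frX : free X := basis_free bas.
apply: inhabits; apply: (@ReducedFrame _ _ f1 f2 f3 (coord X ord0)
  (coord X (lift ord0 ord0)) (coord X (lift ord0 (lift ord0 ord0)))) => //.
  move=> z; have := coord_basis (bas : basis_of fullv X) (memvf z).
  by rewrite !big_ord_recl big_ord0 addr0 addrA.
move=> a b c.
pose k (i : 'I_3) := [:: a; b; c]`_i.
have -> : a *: f1 + b *: f2 + c *: f3 = \sum_(i < 3) k i *: X`_i.
  by rewrite !big_ord_recl big_ord0 addr0 addrA.
by rewrite /= !coord_sum_free.
Qed.

Lemma geodesic_reduced (R : realType) (Phi : 'End(sl2 R)) (F : reduced_frame Phi)
    (J : set R) (z : R -> sl2 R) :
  geodesic_on Phi J z ->
  reduced_solution J (coord1 F \o z) (coord2 F \o z) (coord3 F \o z).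
Proof.
move=> [_ _ _ geo] t Jt; have := geo t Jt; rewrite -vsval_lie => dz.
have dc (c : {scalar sl2 R}) :
    is_derive t (1 : R) (c \o z) (c (lie (z t) ((Phi^-1)%VF (z t)))).
  (* Derivatives are taken in the space of all matrices, so the form [c] is extended to it through
     the projection. *)
  have := is_derive_scalar_mx (c \o vsproj (sl2v R)) dz.
  rewrite [X in is_derive _ _ X](_ : _ = c \o z); first by rewrite /= vsvalK.
  by apply/funext => s /=; rewrite vsvalK.
have := frame_lieE F (coord1 F (z t)) (coord2 F (z t)) (coord3 F (z t)).
rewrite /= -frame_coordE => lieE.
have [E1 E2 E3] := coord_frameE F (coord3 F (z t) * coord1 F (z t))
  (- (coord3 F (z t) * coord2 F (z t)))
  (- (coord1 F (z t) ^+ 2 + coord2 F (z t) ^+ 2)).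
have := dc (coord1 F); have := dc (coord2 F); have := dc (coord3 F).
by rewrite lieE E1 E2 E3.
Qed.

Lemma reduced_geodesic (R : realType) (Phi : 'End(sl2 R)) (F : reduced_frame Phi)
    (J : set R) (u v w : R -> R) :
  J !=set0 -> open J -> is_interval J -> reduced_solution J u v w ->
  geodesic_on Phi J
    (fun t => u t *: frame1 F + v t *: frame2 F + w t *: frame3 F).
Proof.
move=> J0 oJ iJ sol; split=> [//|//|//|t Jt]; have [du dv dw] := sol t Jt.
rewrite -vsval_lie frame_lieE; apply/is_derive_mxP => i j.
have -> : (fun s => vsval (u s *: frame1 F + v s *: frame2 F + w s *: frame3 F) i j)
    = vsval (frame1 F) i j \*: u + vsval (frame2 F) i j \*: v
      + vsval (frame3 F) i j \*: w.
  by apply/funext => s; rewrite sl2_combE mulrC [v s * _]mulrC [w s * _]mulrC.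
apply: is_derive_eq
  (is_deriveD (is_deriveD (is_deriveZ _ du) (is_deriveZ _ dv)) (is_deriveZ _ dw)) _.
by rewrite sl2_combE; congr (_ + _ + _); exact: mulrC.
Qed.

(** * The planes [v = 0] and [u = 0], and the geodesics over and off them *)

Lemma mem_frame13 (R : realType) (Phi : 'End(sl2 R)) (F : reduced_frame Phi) z :
  z \in <<[:: frame1 F; frame3 F]>>%VS <-> coord2 F z = 0.
Proof.
rewrite span_cons span_seq1; split=> [|z0].
  case/memv_addP => _ /vlineP[a ->] [_ /vlineP[c ->] ->].
  by have [_ + _] := coord_frameE F a 0 c; rewrite scale0r addr0.
rewrite (frame_coordE F z) z0 scale0r addr0.
by apply: memv_add; rewrite memvZ ?memv_line.
Qed.

Lemma mem_frame23 (R : realType) (Phi : 'End(sl2 R)) (F : reduced_frame Phi) z :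
  z \in <<[:: frame2 F; frame3 F]>>%VS <-> coord1 F z = 0.
Proof.
rewrite span_cons span_seq1; split=> [|z0].
  case/memv_addP => _ /vlineP[b ->] [_ /vlineP[c ->] ->].
  by have [+ _ _] := coord_frameE F 0 b c; rewrite scale0r add0r.
rewrite (frame_coordE F z) z0 scale0r add0r.
by apply: memv_add; rewrite memvZ ?memv_line.
Qed.

Lemma dim_frame13 (R : realType) (Phi : 'End(sl2 R)) (F : reduced_frame Phi) :
  \dim <<[:: frame1 F; frame3 F]>> = 2%N.
Proof.
apply/eqP; have := frame_free F.
rewrite (perm_free (_ : perm_eq _ [:: frame2 F; frame1 F; frame3 F])).
  by rewrite free_cons => /andP[].
by rewrite (perm_catCA [:: frame1 F] [:: frame2 F]).
Qed.

Lemma dim_frame23 (R : realType) (Phi : 'End(sl2 R)) (F : reduced_frame Phi) :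
  \dim <<[:: frame2 F; frame3 F]>> = 2%N.
Proof. by apply/eqP; have := frame_free F; rewrite free_cons => /andP[]. Qed.

Lemma invariant_frame13 (R : realType) (Phi : 'End(sl2 R))
    (F : reduced_frame Phi) :
  invariant_plane Phi <<[:: frame1 F; frame3 F]>>.
Proof.
split; first exact: dim_frame13.
move=> J z [geo _] t0 Jt0 /mem_frame13 zt0 t Jt; apply/mem_frame13.
have [_ _ iJ _] := geo.
exact: (reduced_solution_v_eq0 iJ (geodesic_reduced F geo) Jt0 Jt).
Qed.

Lemma invariant_frame23 (R : realType) (Phi : 'End(sl2 R))
    (F : reduced_frame Phi) :
  invariant_plane Phi <<[:: frame2 F; frame3 F]>>.
Proof.
split; first exact: dim_frame23.
move=> J z [geo _] t0 Jt0 /mem_frame23 zt0 t Jt; apply/mem_frame23.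
have [_ _ iJ _] := geo.
exact: (reduced_solution_u_eq0 iJ (geodesic_reduced F geo) Jt0 Jt).
Qed.

(** [reduced_solution_extension] gives a geodesic on the whole line that extends [z], and maximality
    identifies the domains. *)
Lemma frame13_complete (R : realType) (Phi : 'End(sl2 R))
    (F : reduced_frame Phi) J z :
  maximal_geodesic Phi J z ->
  lies_over <<[:: frame1 F; frame3 F]>>%VS J z -> complete_domain J.
Proof.
move=> [geo maxJ] over; have [J0 _ iJ _] := geo.
have z2 t : J t -> coord2 F (z t) = 0 by move=> /over/mem_frame13.
have [u [w [sol uw]]] := reduced_solution_extension J0 iJ (geodesic_reduced F geo) z2.
have geoT : geodesic_on Phi setT
    (fun t => u t *: frame1 F + 0 *: frame2 F + w t *: frame3 F).
  apply: reduced_geodesic sol; [by exists 0|exact: openT|by []].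
apply/esym; apply: (maxJ _ _ geoT); first exact: subsetT.
move=> t; rewrite inE => Jt; have [-> ->] := uw t Jt.
by rewrite -[in RHS](z2 t Jt); exact: frame_coordE.
Qed.

(** The fixed point at the origin serves as the half-complete geodesic over the second plane. *)
Lemma maximal_geodesic0 (R : realType) (Phi : 'End(sl2 R))
    (F : reduced_frame Phi) : maximal_geodesic Phi setT (fun=> 0).
Proof.
split; last by move=> J' z' _ TJ' _; apply/seteqP; split.
have -> : (fun=> 0) = (fun t : R => (0 : R) *: frame1 F + (0 : R) *: frame2 F
    + (0 : R) *: frame3 F).
  by apply/funext => t; rewrite !scale0r !addr0.
apply: (@reduced_geodesic _ _ F _ (fun=> 0) (fun=> 0) (fun=> 0));
  [by exists 0|exact: openT|by []|move=> t _].
by rewrite mul0r expr0n/= addr0 oppr0; split; exact: is_derive_cst.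
Qed.

Lemma maximal_geodesic_tan (R : realType) (Phi : 'End(sl2 R))
    (F : reduced_frame Phi) :
  maximal_geodesic Phi `](- (pi / 2)), (pi / 2)[%classic
    (fun t => 0 *: frame1 F + (cos t)^-1 *: frame2 F + - tan t *: frame3 F).
Proof.
have pi20 : 0 < pi / 2 :> R by rewrite divr_gt0 ?pi_gt0.
set J := `](- (pi / 2)), (pi / 2)[%classic.
have J0 : J 0 by rewrite /J/= in_itv/= oppr_lt0 pi20.
split.
  apply: reduced_geodesic (@reduced_solution_tan R).
  - by exists 0.
  - exact: interval_open.
  - exact: interval_is_interval.
move=> J' z' geo JJ' zz'; have [_ _ iJ' _] := geo.
have J'0 := JJ' _ J0.
have := zz' 0; rewrite inE => /(_ J0); rewrite cos0 tan0 invr1 oppr0 => z0.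
have [E1 E2 E3] := coord_frameE F 0 1 0.
have c0 e : J' e -> cos e != 0.
  by apply: (reduced_solution_cos_neq0 iJ' (geodesic_reduced F geo) J'0);
    rewrite /= -z0.
(* An extension past either end would contain [pi / 2] or [- pi / 2], its domain being an interval
   through 0; but [cos] vanishes there. *)
apply/seteqP; split=> // t J't; rewrite /J/= in_itv/=.
apply/andP; split; rewrite ltNge; apply/negP => le.
  have /c0 : J' (- (pi / 2)).
    by apply: (iJ' _ _ J't J'0); rewrite le oppr_le0 ltW.
  by rewrite cosN cos_pihalf eqxx.
have /c0 : J' (pi / 2) by apply: (iJ' _ _ J'0 J't); rewrite le ltW.
by rewrite cos_pihalf eqxx.
Qed.

(** By invariance, a geodesic that does not lie over a plane is off it at every instant; so [u] and
    [v] are both nonzero at [t0]. *)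
Lemma frame_generic_finite (R : realType) (Phi : 'End(sl2 R))
    (F : reduced_frame Phi) J z :
  maximal_geodesic Phi J z ->
  ~ lies_over <<[:: frame1 F; frame3 F]>>%VS J z ->
  ~ lies_over <<[:: frame2 F; frame3 F]>>%VS J z -> finite_domain J.
Proof.
move=> mz n1 n2; have [geo _] := mz; have [[t0 Jt0] oJ iJ _] := geo.
have [_ inv13] := invariant_frame13 F; have [_ inv23] := invariant_frame23 F.
have z1 : coord1 F (z t0) != 0.
  by apply/eqP => /mem_frame23 /(inv23 J z mz t0 Jt0).
have z2 : coord2 F (z t0) != 0.
  by apply/eqP => /mem_frame13 /(inv13 J z mz t0 Jt0).
have [uJ lJ] := reduced_solution_bounded iJ (geodesic_reduced F geo) Jt0 z1 z2.
by apply: open_itv_finite_domain => //; exists t0.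
Qed.

Theorem theorem1p3 (R : realType) (q : {symmetric (sl2 R)})
    (Phi : 'End(sl2 R)) :
  nondegenerate q ->
  is_associated_iso q Phi ->
  (exists l1 l2 : R[i],
     [/\ l1 != l2, complex.Im l1 != 0, complex.Im l2 != 0,
         complex_eigenvalue Phi l1 & complex_eigenvalue Phi l2]) ->
  exists P1 P2 : {vspace sl2 R},
    [/\ invariant_plane Phi P1,
        forall J z, maximal_geodesic Phi J z -> lies_over P1 J z -> complete_domain J,
        invariant_plane Phi P2,
        [/\ exists J z, [/\ maximal_geodesic Phi J z, lies_over P2 J z
              & Rplus_complete_domain J \/ Rminus_complete_domain J],
            exists J z, [/\ maximal_geodesic Phi J z, lies_over P2 J z
              & finite_domain J]
          & forall J z, maximal_geodesic Phi J z -> lies_over P2 J z ->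
              [\/ Rplus_complete_domain J, Rminus_complete_domain J | finite_domain J]]
      & forall J z, maximal_geodesic Phi J z ->
          ~ lies_over P1 J z -> ~ lies_over P2 J z -> finite_domain J].
Proof.
move=> _ [Phi0 PhiB _] [l [_ [_ l0 _ Phil _]]].
have [F] := reduced_frame_exists Phi0 PhiB Phil l0.
exists <<[:: frame1 F; frame3 F]>>%VS, <<[:: frame2 F; frame3 F]>>%VS.
split.
- exact: invariant_frame13.
- by move=> J z; exact: frame13_complete.
- exact: invariant_frame23.
- split.
  + exists setT, (fun=> 0); split; first exact: (maximal_geodesic0 F).
      by move=> t _; exact: mem0v.
    by left => -[b /(_ (b + 1) I)]; rewrite gerDl ler10.
  + exists `](- (pi / 2)), (pi / 2)[%classic.
    eexists; split; first exact: (maximal_geodesic_tan F).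
      move=> t _; apply/mem_frame23.
      by have [-> _ _] := coord_frameE F 0 (cos t)^-1 (- tan t).
    exists (- (pi / 2)), (pi / 2); split=> //.
    by rewrite gtrN// divr_gt0 ?pi_gt0.
  (* A trichotomy for open intervals: unbounded above, unbounded below, or bounded. *)
  + move=> J z [[J0 oJ iJ _] _] _.
    have [uJ|] := pselect (has_ubound J); last by constructor 1.
    have [lJ|] := pselect (has_lbound J); last by constructor 2.
    by constructor 3; exact: open_itv_finite_domain.
- by move=> J z; exact: frame_generic_finite.
Qed.
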